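(* Let $n \ge 1$, let $A_L, A_R \in \mathbb{R}^{n \times n}$ be matrices that differ only in their first columns, let $b \in \mathbb{R}^n$ and $\mu \in \mathbb{R}$, and consider the continuous piecewise-linear ODE system $$\dot{x} = \begin{cases} A_L x + b \mu, & x_1 \le 0, \\ A_R x + b \mu, & x_1 \ge 0, \end{cases} \qquad x = (x_1,\ldots,x_n) \in \mathbb{R}^n .$$ If $\det(A_L) \ne 0$, $\det(A_R) \ne 0$, and both equilibria $x^L(\mu) = -A_L^{-1} b \mu$ and $x^R(\mu) = -A_R^{-1} b \mu$ of the two pieces of the system are virtual, then every solution to the system diverges as $t \to \pm\infty$.
   Context: A subscript $1$ on a vector denotes its first component. The equilibrium $x^L(\mu)$ of the left piece is called virtual if $x^L_1(\mu) > 0$ (and admissible if $x^L_1(\mu) < 0$); the equilibrium $x^R(\mu)$ of the right piece is called virtual if $x^R_1(\mu) < 0$ (and admissible if $x^R_1(\mu) > 0$). The right-hand side is globally Lipschitz, so solutions $\phi(t)$ are defined for all $t \in \mathbb{R}$. A solution $\phi(t)$ diverges as $t \to \pm \infty$ if $\|\phi(t)\| \to \infty$ both as $t \to \infty$ and as $t \to -\infty$, where $\|\cdot\|$ is the Euclidean norm. *)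

(* Defs.v *)
From HB Require Import structures.
From mathcomp Require Import all_boot all_order all_algebra.
From mathcomp Require Import all_classical all_reals all_analysis.
Set Implicit Arguments.
Unset Strict Implicit.
Unset Printing Implicit Defensive.
Import Order.TTheory GRing.Theory Num.Theory.
Import numFieldNormedType.Exports.
Local Open Scope classical_set_scope.
Local Open Scope ring_scope.

Section PiecewiseLinear.
Variables (R : realType) (n : nat).
Implicit Types (A AL AR : 'M[R]_n.+1) (b x : 'cV[R]_n.+1) (mu : R).

Definition fst_comp x : R := x ord0 ord0.

(* The library norm `|x| on matrices is the sup norm. *)
Definition enorm x : R := Num.sqrt (\sum_i x i ord0 ^+ 2).

Definition differ_only_fst_col AL AR : Prop :=
  forall i j, j != ord0 -> AL i j = AR i j.

Definition affine_piece A b mu x : 'cV[R]_n.+1 := A *m x + mu *: b.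

Definition pwl_field AL AR b mu x : 'cV[R]_n.+1 :=
  if fst_comp x <= 0 then affine_piece AL b mu x else affine_piece AR b mu x.

(* The two pieces agree on the switching hyperplane, so that the asymmetric
   test in pwl_field is immaterial. *)
Lemma pwl_field_right AL AR b mu x :
  differ_only_fst_col AL AR -> 0 <= fst_comp x ->
  pwl_field AL AR b mu x = affine_piece AR b mu x.
Proof.
move=> dif x_ge0; rewrite /pwl_field; case: ifP => // x_le0.
have x0 : x ord0 ord0 = 0 by apply/eqP; rewrite eq_le x_le0.
rewrite /affine_piece; congr (_ + _); apply/matrixP => i k.
rewrite !mxE; apply: eq_bigr => j _; rewrite (ord1 k).
by have [->|/dif ->//] := eqVneq j ord0; rewrite x0 !mulr0.
Qed.

Definition solution AL AR b mu (phi : R -> 'cV[R]_n.+1) : Prop :=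
  forall t : R, is_derive t 1 phi (pwl_field AL AR b mu (phi t)).

(* Meaningful when A is invertible; invmx A = A otherwise. *)
Definition equilibrium A b mu : 'cV[R]_n.+1 := - invmx A *m (mu *: b).

Definition left_virtual AL b mu : Prop := 0 < fst_comp (equilibrium AL b mu).

Definition right_virtual AR b mu : Prop := fst_comp (equilibrium AR b mu) < 0.

Definition diverges (phi : R -> 'cV[R]_n.+1) : Prop :=
  enorm (phi t) @[t --> +oo] --> +oo /\ enorm (phi t) @[t --> -oo] --> +oo.

End PiecewiseLinear.

(* Main.v *)
Require Import Defs.
From mathcomp Require Import all_boot all_order all_algebra.
From mathcomp Require Import all_classical all_reals all_analysis.
Set Implicit Arguments.
Unset Strict Implicit.
Unset Printing Implicit Defensive.
Import Order.TTheory GRing.Theory Num.Theory.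
Import numFieldNormedType.Exports.
Local Open Scope classical_set_scope.
Local Open Scope ring_scope.

(* Since A_L and A_R differ only in their first columns, the first rows r_L and
   r_R of their inverses are proportional: r_L A_R vanishes off the first
   coordinate, so r_L = k r_R.  Hence q := - r_L / x^L_1 = - r_R / x^R_1 satisfies
   q . (b mu) = 1, q A_L = - e_1 / x^L_1 and q A_R = - e_1 / x^R_1, and along any
   solution the derivative of q . x is 1 - x_1 / x^L_1 if x_1 <= 0 and
   1 - x_1 / x^R_1 if x_1 >= 0.  Virtuality of the equilibria makes this at least
   1 everywhere, so q . x grows at least linearly, and it is bounded by a multiple
   of the norm of x. *)

Lemma row0_invmx_proportional (F : fieldType) (n : nat) (AL AR : 'M[F]_n.+1) :
  (forall i j, j != ord0 -> AL i j = AR i j) ->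
  AL \in unitmx -> AR \in unitmx ->
  exists k, row ord0 (invmx AL) = k *: row ord0 (invmx AR).
Proof.
move=> dif uL uR; pose r := row ord0 (invmx AL); exists ((r *m AR) ord0 ord0).
have -> : row ord0 (invmx AL) = r *m AR *m invmx AR by rewrite mulmxK.
suff {1}-> : r *m AR = (r *m AR) ord0 ord0 *: delta_mx ord0 ord0.
  by rewrite -scalemxAl -rowE.
apply/rowP => j; rewrite [RHS]mxE [delta_mx _ _ _ _]mxE eqxx /=.
have [->|j0] := eqVneq j ord0; first by rewrite mulr1.
(* Off column [ord0] the matrices agree, and [r *m AL] is the first row of the identity, so this
   entry is 0. *)
have -> : (r *m AR) ord0 j = (r *m AL) ord0 j.
  by rewrite !mxE; apply: eq_bigr => i _; rewrite dif.
by rewrite -row_mul mulVmx // !mxE eq_sym (negPf j0) mulr0.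
Qed.

Lemma is_derive_coord (R : realType) (m n : nat) (M : R -> 'M[R]_(m, n))
    (t v : R) (dM : 'M[R]_(m, n)) (i : 'I_m) (j : 'I_n) :
  is_derive t v M dM -> is_derive t v (fun s => M s i j) (dM i j).
Proof.
move=> [dvM <-]; apply: DeriveDef; first exact: (derivable_mxP M t v).1.
by rewrite derive_mx // mxE.
Qed.

Lemma is_derive_mulmx (R : realType) (n : nat) (q : 'rV[R]_n)
    (phi : R -> 'cV[R]_n) (t v : R) (dphi : 'cV[R]_n) :
  is_derive t v phi dphi ->
  is_derive t v (fun s => (q *m phi s) ord0 ord0) ((q *m dphi) ord0 ord0).
Proof.
move=> dp; rewrite mxE.
have -> : (fun s => (q *m phi s) ord0 ord0) =
    \sum_(j < n) (q ord0 j *: (fun s => phi s j ord0)).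
  by apply/funext => s; rewrite mxE fct_sumE.
by apply: is_derive_sum => j; apply: is_deriveZ; exact: is_derive_coord.
Qed.

(** Each [x j ord0 ^+ 2] is one term of the sum under the root, so every coordinate is at most
    [enorm x] in absolute value. Any constant depending on [q] alone would do. *)
Lemma normr_mulmx_le (R : realType) (n : nat) (q : 'rV[R]_n.+1)
    (x : 'cV[R]_n.+1) :
  `|(q *m x) ord0 ord0| <= (\sum_j `|q ord0 j|) * enorm x.
Proof.
rewrite mxE mulr_suml (le_trans (ler_norm_sum _ _ _))//.
apply: ler_sum => j _; rewrite normrM ler_wpM2l// /enorm -sqrtr_sqr.
apply: ler_wsqrtr; rewrite (bigD1 j)//= lerDl.
by apply: sumr_ge0 => i _; exact: sqr_ge0.
Qed.

(** Mean value theorem. Both endpoints are free: fixing [s] at 0 serves the limit at [+oo], fixing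
    [t] at 0 the limit at [-oo]. *)
Lemma derive_ge1_growth (R : realType) (V dV : R -> R) :
  (forall t : R, is_derive t 1 V (dV t)) -> (forall t, 1 <= dV t) ->
  forall s t : R, s <= t -> t - s <= V t - V s.
Proof.
move=> VdV dV1 s t st.
have [|c _ ->] := MVT_segment st (fun x _ => VdV x).
  apply: derivable_within_continuous => x _.
  exact: (@ex_derive _ _ _ _ _ _ _ (VdV x)).
by rewrite ler_peMl ?subr_ge0.
Qed.

Section VirtualEquilibria.
Variables (R : realType) (n : nat) (AL AR : 'M[R]_n.+1).
Variables (b : 'cV[R]_n.+1) (mu : R).

Lemma fst_comp_equilibrium (A : 'M[R]_n.+1) :
  fst_comp (equilibrium A b mu) =
  - (row ord0 (invmx A) *m (mu *: b)) ord0 ord0.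
Proof. by rewrite /fst_comp /equilibrium mulNmx -row_mul !mxE. Qed.

(** [invmx A] turns the affine field into the displacement of [x] from the equilibrium, whose first
    component is read off. *)
Lemma row0_invmx_affine_piece (A : 'M[R]_n.+1) (x : 'cV[R]_n.+1) :
  A \in unitmx ->
  (row ord0 (invmx A) *m affine_piece A b mu x) ord0 ord0 =
  fst_comp x - fst_comp (equilibrium A b mu).
Proof.
move=> uA; rewrite fst_comp_equilibrium opprK /affine_piece mulmxDr mxE.
by rewrite mulmxA -row_mul mulVmx // -row_mul mul1mx [row _ _ _ _]mxE.
Qed.

Lemma exists_growing_functional :
  differ_only_fst_col AL AR -> \det AL != 0 -> \det AR != 0 ->
  left_virtual AL b mu -> right_virtual AR b mu ->
  exists q : 'rV[R]_n.+1,
    forall x, 1 <= (q *m pwl_field AL AR b mu x) ord0 ord0.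
Proof.
rewrite /left_virtual /right_virtual => dif dL dR vL vR.
have uL : AL \in unitmx by rewrite unitmxE unitfE.
have uR : AR \in unitmx by rewrite unitmxE unitfE.
have [k rLR] := row0_invmx_proportional dif uL uR.
set xL := fst_comp (equilibrium AL b mu) in vL.
set xR := fst_comp (equilibrium AR b mu) in vR.
have xLR : xL = k * xR.
  by rewrite /xL /xR !fst_comp_equilibrium rLR -scalemxAl mxE mulrN.
(* Needed to cancel [k] on the right piece. *)
have k0 : k != 0 by apply: contraTneq vL => k0; rewrite xLR k0 mul0r ltxx.
exists (- xL^-1 *: row ord0 (invmx AL)) => x.
rewrite /pwl_field; case: ifPn => [x0|].
  rewrite -scalemxAl mxE row0_invmx_affine_piece // -/xL.
  rewrite mulrBr mulNr [_ * xL]mulNr mulVf ?gt_eqF // opprK lerDr.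
  by rewrite oppr_ge0 mulr_ge0_le0 // invr_ge0 ltW.
rewrite -ltNge => x0.
rewrite rLR scalerA -scalemxAl mxE row0_invmx_affine_piece // -/xR.
(* Since [xL = k * xR], the normalisation chosen for the left piece is also the correct one for the
   right piece. *)
have -> : - xL^-1 * k = - xR^-1.
  by rewrite xLR invfM mulNr mulrAC mulVf // mul1r.
rewrite mulrBr mulNr [_ * xR]mulNr mulVf ?lt_eqF // opprK lerDr.
by rewrite oppr_ge0 mulr_le0_ge0 ?invr_le0 // ltW.
Qed.

End VirtualEquilibria.

Theorem theorem3 (R : realType) (n : nat) (AL AR : 'M[R]_n.+1)
    (b : 'cV[R]_n.+1) (mu : R)
    (hA : differ_only_fst_col AL AR)
    (hL : \det AL != 0) (hR : \det AR != 0)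
    (hvL : left_virtual AL b mu) (hvR : right_virtual AR b mu)
    (phi : R -> 'cV[R]_n.+1) (hphi : solution AL AR b mu phi) :
  diverges phi.
Proof.
have [q q1] := exists_growing_functional hA hL hR hvL hvR.
pose V t := (q *m phi t) ord0 ord0.
have growth := derive_ge1_growth (fun t => is_derive_mulmx q (hphi t))
  (fun t => q1 (phi t)).
(* The added 1 gives [0 < K] without first showing that [q] is nonzero. *)
pose K := 1 + \sum_j `|q ord0 j|.
have K0 : 0 < K by rewrite ltr_pwDl // sumr_ge0.
have VK t : `|V t| <= K * enorm (phi t).
  by rewrite (le_trans (normr_mulmx_le q (phi t)))// ler_wpM2r ?sqrtr_ge0 ?lerDr.
split; apply/cvgryPge => M; near=> t; rewrite -(ler_pM2l K0);
  apply: le_trans (VK t).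
(* Forward in time [V t] is at least [V 0 + t], so [t] beyond [K * M - V 0] suffices. *)
- have t0 : 0 <= t by near: t; apply: nbhs_pinfty_ge; exact: num_real.
  rewrite (le_trans _ (ler_norm _))// -(lerD2r (- V 0)).
  rewrite (le_trans _ (growth 0 t t0))// subr0.
  by near: t; apply: nbhs_pinfty_ge; exact: num_real.
(* Backward in time [V] tends to [-oo], so the absolute value is bounded below through [- V t]. *)
- have t0 : t <= 0 by near: t; apply: nbhs_ninfty_le; exact: num_real.
  rewrite -normrN (le_trans _ (ler_norm _))// -(lerD2l (V 0)).
  rewrite (le_trans _ (growth t 0 t0))// sub0r lerNr.
  by near: t; apply: nbhs_ninfty_le; exact: num_real.
Unshelve. all: by end_near.
Qed.
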